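(* Let $K\in\mathcal{B}(\mathcal{H})$ and let $(\Phi,\Psi)=(\{\Phi_i\}_{i\in I},\{\Psi_i\}_{i\in I})$, with $\Phi_i,\Psi_i\in\mathcal{B}(\mathcal{H},\mathcal{K}_i)$ for all $i\in I$, be a bi-$g$-frame for $\mathcal{H}$ with respect to $\{\mathcal{K}_i\}_{i\in I}$, with bi-$g$-frame operator $S_{\Phi,\Psi}$. Then $(\Phi,\Psi)$ is a tight $K$-bi-$g$-frame for $\mathcal{H}$ with respect to $\{\mathcal{K}_i\}_{i\in I}$ if and only if there exists $A>0$ such that $S_{\Phi,\Psi}=A\,KK^{*}$.
   Context: $\mathcal{H}$ is a separable Hilbert space, $I$ is a finite or countable index set, and $\{\mathcal{K}_i\}_{i\in I}$ is a sequence of closed subspaces of $\mathcal{H}$. $\mathcal{B}(\mathcal{H},\mathcal{K})$ is the set of bounded linear operators $\mathcal{H}\to\mathcal{K}$, and $\mathcal{B}(\mathcal{H})=\mathcal{B}(\mathcal{H},\mathcal{H})$. A pair $(\{\Phi_i\}_{i\in I},\{\Psi_i\}_{i\in I})$ with $\Phi_i,\Psi_i\in\mathcal{B}(\mathcal{H},\mathcal{K}_i)$ is a bi-$g$-frame for $\mathcal{H}$ with respect to $\{\mathcal{K}_i\}_{i\in I}$ if there exist constants $0<A\le B<\infty$ such that $A\|x\|^2\le\sum_{i\in I}\langle\Phi_i x,\Psi_i x\rangle\le B\|x\|^2$ for all $x\in\mathcal{H}$. For $K\in\mathcal{B}(\mathcal{H})$, the pair is a tight $K$-bi-$g$-frame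 with bound $A>0$ if $A\|K^{*}x\|^2=\sum_{i\in I}\langle\Phi_i x,\Psi_i x\rangle$ for all $x\in\mathcal{H}$; it is a tight $K$-bi-$g$-frame if this holds for some $A>0$. The bi-$g$-frame operator is $S_{\Phi,\Psi}:\mathcal{H}\to\mathcal{H}$, $S_{\Phi,\Psi}x=\sum_{i\in I}\Psi_i^{*}\Phi_i x$. *)

(* Defs.v *)
From HB Require Import structures.
From mathcomp Require Import all_boot all_order all_algebra finmap.
From mathcomp Require Import complex.
From mathcomp Require Import all_classical all_reals topology normedtype.
From mathcomp Require Import sesquilinear.
From mathcomp Require summability.

Set Implicit Arguments.
Unset Strict Implicit.
Unset Printing Implicit Defensive.
Import Order.TTheory GRing.Theory Num.Theory Num.Def.
Import numFieldNormedType.Exports.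

Local Open Scope classical_set_scope.
Local Open Scope ring_scope.
Local Open Scope complex_scope.

HB.mixin Record CompleteNormedModule_isHilbert (R : realType) H
    of CompleteNormedModule R[i] H := {
  inner : {dot H for @conjC R[i]} ;
  inner_normE : forall x : H, `|x| ^+ 2 = inner x x
}.

#[short(type="hilbertType")]
HB.structure Definition Hilbert (R : realType) :=
  {H of CompleteNormedModule R[i] H & CompleteNormedModule_isHilbert R H}.

Notation "''[' x , y ]" := (inner x y) : ring_scope.

Definition separable (T : topologicalType) :=
  exists A : set T, countable A /\ dense A.

HB.mixin Record isBoundedOp (K : numFieldType) (U V : normedModType K)
    (f : U -> V) := {
  bounded_opP : exists M : K, forall x, `|f x| <= M * `|x|
}.

HB.structure Definition BoundedOp (K : numFieldType) (U V : normedModType K) :=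
  {f of @GRing.Linear K U V *:%R f & isBoundedOp K U V f}.

Notation "''B' ( U , V )" := (@BoundedOp.type _ U%type V%type)
  (at level 8, format "''B' ( U ,  V )") : type_scope.

HB.mixin Record isClosedPred (T : topologicalType) (P : {pred T}) := {
  closed_predP : closed [set` P]
}.

#[short(type="closedSubspace")]
HB.structure Definition ClosedSubspace (R : realType) (H : hilbertType R) :=
  {P of @GRing.SubmodClosed R[i] H P & isClosedPred H P}.

Section subspace_hilbert.
Variables (R : realType) (H : hilbertType R) (V : closedSubspace H).

Definition subspace_of : predArgType := {x : H | x \in (V : {pred H})}.

HB.instance Definition _ := [isSub of subspace_of for @sval _ _].
HB.instance Definition _ := [Choice of subspace_of by <:].
HB.instance Definition _ := [SubChoice_isSubLmodule of subspace_of by <:].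

Let norm_sub (x : subspace_of) : R[i] := `|val x|.

Let norm_subD x y : norm_sub (x + y) <= norm_sub x + norm_sub y.
Proof. by rewrite /norm_sub raddfD ler_normD. Qed.

Let norm_subZ l x : norm_sub (l *: x) = `|l| * norm_sub x.
Proof. by rewrite /norm_sub linearZ normrZ. Qed.

Let norm_sub_eq0 x : norm_sub x = 0 -> x = 0.
Proof. by move/normr0_eq0 => x0; apply: val_inj; rewrite x0 raddf0. Qed.

HB.instance Definition _ := @Lmodule_isNormed.Build R[i] subspace_of
  norm_sub norm_subD norm_subZ norm_sub_eq0.

Let val_cvg (F : set_system subspace_of) (y : subspace_of) :
  ProperFilter F -> (val @ F --> val y) -> F --> y.
Proof.
move=> FF /cvgrPdist_lt Fy; apply/cvgrPdist_lt => e e0.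
by apply: filterS (Fy e e0) => z; rewrite -[ `|y - z|]/(`|val (y - z)|) raddfB.
Qed.

Let sub_complete (F : set_system subspace_of) :
  ProperFilter F -> cauchy F -> cvg F.
Proof.
move=> FF /cauchy_ballP Fc.
have /cauchy_cvg : cauchy (val @ F).
  apply/cauchy_ballP => e e0; have := Fc e e0.
  rewrite !near_simpl/= => -[[P Q]/= [FP FQ] PQ].
  exists ([set val x | x in P], [set val x | x in Q]) => /=.
    split; first by apply: filterS FP => x Px /=; exists x.
    by apply: filterS FQ => x Qx /=; exists x.
  move=> [_ _]/= [[x Px <-] [y Qy <-]].
  have := PQ (x, y) (conj Px Qy).
  rewrite -!ball_normE /ball_/=.
  by rewrite -[ `|x - y|]/(`|val (x - y)|) raddfB.
move/cvg_ex => [l Fl].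
have Vl : l \in (V : {pred H}).
  apply: (closed_cvg (fun z => z \in (V : {pred H})) _ _ _ Fl) => //.
    exact: closed_predP.
  by apply: nearW => x /=; exact: (valP x).
by apply/cvg_ex; exists (Sub l Vl); apply: val_cvg; rewrite SubK.
Qed.

HB.instance Definition _ := @Uniform_isComplete.Build subspace_of sub_complete.

Definition sub_inner (x y : subspace_of) : R[i] := '[val x, val y].

Let sub_inner_bilinear :
  bilinear_for *%R (conjC \; *%R : R[i] -> R[i] -> R[i]) sub_inner.
Proof.
split=> [u' a x y|u a x y]; rewrite /sub_inner.
  have -> : val (a *: x + y) = a *: val x + val y by exact: linearP.
  by rewrite linearDl linearZl_LR.
have -> : val (a *: x + y) = a *: val x + val y by exact: linearP.
by rewrite linearDr linearZr_LR.
Qed.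

HB.instance Definition _ := bilinear_isBilinear.Build R[i] subspace_of
  subspace_of R[i] *%R (conjC \; *%R) sub_inner sub_inner_bilinear.

Let sub_inner_hermitian x y :
  sub_inner x y = (-1) ^+ false * conjC (sub_inner y x).
Proof. exact: hermitian_subproof. Qed.

HB.instance Definition _ := isHermitianSesquilinear.Build R[i] subspace_of
  false conjC sub_inner sub_inner_hermitian.

Let sub_inner_gt0 x : x != 0 -> 0 < sub_inner x x.
Proof.
by move=> x0; apply: neq0_dnorm_gt0; rewrite -(inj_eq val_inj) raddf0 in x0.
Qed.

HB.instance Definition _ := isDotProduct.Build R[i] subspace_of
  sub_inner sub_inner_gt0.

Let sub_inner_normE (x : subspace_of) : `|x| ^+ 2 = sub_inner x x.
Proof. exact: (inner_normE (val x)). Qed.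

HB.instance Definition _ := CompleteNormedModule_isHilbert.Build R subspace_of
  sub_inner_normE.

End subspace_hilbert.

Section bi_g_frames.
Variables (R : realType) (H : hilbertType R).

(* The vector representing x |-> '[T x, y], which exists and is unique by the
   Riesz representation theorem, H being complete. *)
Definition adjoint (H' : hilbertType R) (T : 'B(H, H')) (y : H') : H :=
  xget 0 [set z | forall x : H, '[T x, y] = '[x, z]].

Variables (I : countType) (V : I -> closedSubspace H).
Variables Phi Psi : forall i, 'B(H, subspace_of (V i)).

(* As I carries no order, sums over I are limits along the directed set of
   finite subsets of I. *)
Let frame_terms (x : H) (i : I) : R[i]^o := '[Phi i x, Psi i x].

Definition frame_summable :=
  forall x, cvg (summability.partial_sum (frame_terms x)
                   @ summability.totally).

Definition frame_sum (x : H) : R[i] := summability.sum (frame_terms x).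

(* The order of R[i] only compares numbers with equal imaginary parts, so the
   inequalities force frame_sum x to be real. *)
Definition bi_g_frame :=
  frame_summable /\
  exists A B : R, [/\ 0 < A, A <= B & forall x : H,
    A%:C * `|x| ^+ 2 <= frame_sum x <= B%:C * `|x| ^+ 2].

Definition tight_K_bi_g_frame (K : 'B(H, H)) :=
  frame_summable /\
  exists2 A : R, 0 < A &
    forall x : H, A%:C * `|adjoint K x| ^+ 2 = frame_sum x.

(* For a bi-g-frame the unconditional convergence of the scalar series implies
   that this series converges in norm. *)
Definition frame_operator (x : H) : H :=
  summability.sum (fun i => adjoint (Psi i) (Phi i x)).

End bi_g_frames.

(* Main.v *)
Require Import Defs.
From mathcomp Require Import all_boot all_order all_algebra complex finmap.
From mathcomp Require Import all_classical all_reals topology normedtype.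
From mathcomp Require Import sesquilinear ring lra.
From mathcomp Require summability.

(** Once the series defining the frame operator [S] is known to converge in
    norm, [S] is linear and [<S x, x> = sum_i <Phi_i x, Psi_i x>], while
    [A |K^* x|^2 = <A K K^* x, x>].  So tightness with bound [A] says that the
    operators [S] and [A K K^*] have the same quadratic form, and on a complex
    Hilbert space an operator is determined by its quadratic form
    ([form_eq0]).  Both implications follow.

    The work lies in the convergence of [S x]: the hypothesis only provides the
    unconditional convergence of the scalar series on the diagonal.  Write
    [P_A x] for the sum of [Psi_i^* Phi_i x] over a finite set [A] of indices.
    - Convergence bounds the partial sums [<P_A x, x>] uniformly in [A], for
      each [x] ([cvg_partial_sum_bounded]).  Polarization turns this into a
      bound on [<P_A x, y>] for each [x] and [y].
    - The uniform boundedness principle ([uniform_boundedness]) then bounds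
      [|P_A x|] uniformly in [A], for each [x].
    - In a Hilbert space, a series whose finite partial sums are all bounded
      converges unconditionally ([bounded_sums_cvg]).  If it did not, there
      would be infinitely many disjoint finite blocks with sums [b_k] of norm
      at least [e]; by the parallelogram law the signs in
      [+-b_1 +- ... +- b_n] can be chosen to make its squared norm at least
      [n e^2], yet it is a difference of two partial sums.

    The adjoints exist by the Riesz representation theorem ([riesz_real]),
    proved by minimizing [|x|^2 - 2 g x]. *)

Set Implicit Arguments.
Unset Strict Implicit.
Unset Printing Implicit Defensive.
Import Order.TTheory GRing.Theory Num.Theory.
Import numFieldNormedType.Exports.

Local Open Scope classical_set_scope.
Local Open Scope ring_scope.
Local Open Scope complex_scope.

#[local] Existing Instance summability.totally_filter.

(** * The real Hilbert space underlying a complex one *)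

Section real_structure.
Variables (R : realType) (H : hilbertType R).
Implicit Types x y z u v : H.

(** The norm of a space over [R[i]] takes its values in [R[i]], which is only
    partially ordered.  Estimates are therefore made in [R], with [rnorm] and
    the real part [rinner] of the inner product, which make [H] a real Hilbert
    space. *)
Definition rnorm x : R := complex.Re `|x|.
Definition rinner x y : R := complex.Re '[x, y].

Lemma normE x : `|x| = (rnorm x)%:C.
Proof. by rewrite /rnorm RRe_real// ger0_real. Qed.

Lemma rnorm_ge0 x : 0 <= rnorm x.
Proof. by rewrite -ler0c -normE. Qed.

Lemma rnorm0_eq0 x : rnorm x = 0 -> x = 0.
Proof. by move=> x0; apply/eqP; rewrite -normr_eq0 normE x0. Qed.

Lemma rnormD x y : rnorm (x + y) <= rnorm x + rnorm y.
Proof. by rewrite -lecR rmorphD/= -!normE ler_normD. Qed.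

Lemma rnormN x : rnorm (- x) = rnorm x.
Proof. by rewrite /rnorm normrN. Qed.

Lemma rnorm_distC x y : rnorm (x - y) = rnorm (y - x).
Proof. by rewrite -rnormN opprB. Qed.

Lemma rnormZ (a : R) x : rnorm (a%:C *: x) = `|a| * rnorm x.
Proof.
apply: complexI; rewrite rmorphM/= -!normE normrZ; congr (_ * _).
by rewrite normc_def/= expr0n addr0 sqrtr_sqr.
Qed.

Lemma rinnerxx x : rinner x x = rnorm x ^+ 2.
Proof. by rewrite /rinner -inner_normE normE -rmorphXn. Qed.

Lemma innerC x y : '[x, y] = conjc '[y, x].
Proof. by rewrite (hermC (inner : {dot H for @Num.conj R[i]})) mul1r. Qed.

Lemma rinnerC x y : rinner x y = rinner y x.
Proof. by rewrite /rinner innerC; case: ('[y, x]). Qed.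

Lemma rinnerDl x y z : rinner (x + y) z = rinner x z + rinner y z.
Proof. by rewrite /rinner linearDl/= raddfD. Qed.

Lemma rinnerDr x y z : rinner z (x + y) = rinner z x + rinner z y.
Proof. by rewrite ![rinner z _]rinnerC rinnerDl. Qed.

Lemma rinnerNl x y : rinner (- x) y = - rinner x y.
Proof. by rewrite /rinner linearNl/= raddfN. Qed.

Lemma rinnerNr x y : rinner x (- y) = - rinner x y.
Proof. by rewrite ![rinner x _]rinnerC rinnerNl. Qed.

Lemma rinnerZl (a : R) x y : rinner (a%:C *: x) y = a * rinner x y.
Proof.
rewrite /rinner linearZl_LR /=.
by case: '[x, y] => r s /=; rewrite mul0r subr0.
Qed.

Lemma rinnerZr (a : R) x y : rinner x (a%:C *: y) = a * rinner x y.
Proof. by rewrite ![rinner x _]rinnerC rinnerZl. Qed.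

Lemma rnorm_sqrD x y :
  rnorm (x + y) ^+ 2 = rnorm x ^+ 2 + rnorm y ^+ 2 + 2 * rinner x y.
Proof.
by rewrite -!rinnerxx rinnerDl !rinnerDr [rinner y x]rinnerC; ring.
Qed.

Lemma parallelogram x y :
  rnorm (x + y) ^+ 2 + rnorm (x - y) ^+ 2 = 2 * (rnorm x ^+ 2 + rnorm y ^+ 2).
Proof. by rewrite !rnorm_sqrD rnormN rinnerNr; ring. Qed.

(** Expand the squared norm of [|y|^2 x - <x, y> y], the component of [x]
    orthogonal to [y] scaled to avoid a division. *)
Lemma cauchy_schwarz x y : `|rinner x y| <= rnorm x * rnorm y.
Proof.
rewrite -(@ler_pXn2r _ 2) ?nnegrE ?mulr_ge0 ?rnorm_ge0//.
rewrite exprMn real_normK ?num_real//.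
have [y0|y0] := eqVneq (rnorm y) 0.
  rewrite y0 (rnorm0_eq0 y0) rinnerC.
  by rewrite -[0](subrr 0) rinnerDl rinnerNl subrr; lra.
have yp : 0 < rnorm y ^+ 2 by rewrite exprn_gt0// lt_def y0 rnorm_ge0.
rewrite -(ler_pM2l yp).
have := sqr_ge0 (rnorm ((rnorm y ^+ 2)%:C *: x + (- rinner x y)%:C *: y)).
rewrite rnorm_sqrD !rnormZ rinnerZl rinnerZr !exprMn !real_normK ?num_real//.
by nra.
Qed.

(** As the inner product is conjugate linear on the right, multiplying [y] by [i]
    turns the imaginary part into the real part. *)
Lemma innerE x y : '[x, y] = rinner x y +i* rinner x ('i%C *: y).
Proof.
rewrite /rinner linearZr_LR /=.
by case: '[x, y] => r s /=; congr (_ +i* _); ring.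
Qed.

Lemma rinner_il x y : rinner ('i%C *: x) y = - rinner x ('i%C *: y).
Proof.
rewrite /rinner linearZl_LR linearZr_LR /=.
by case: '[x, y] => r s /=; ring.
Qed.

Lemma inner_eq x y : (forall z, '[z, x] = '[z, y]) -> x = y.
Proof.
move=> xy; apply/subr0_eq/rnorm0_eq0/eqP; rewrite -sqrf_eq0 -rinnerxx.
by rewrite rinnerDr rinnerNr /rinner xy subrr.
Qed.

Lemma cvg_rnormP (T : Type) (F : set_system T) (f : T -> H) l : Filter F ->
  f @ F --> l <-> forall e : R, 0 < e -> \forall t \near F, rnorm (l - f t) < e.
Proof.
move=> FF; split.
  move=> /cvgrPdist_lt fl e e0.
  have e0C : 0 < e%:C by rewrite ltcR.
  by apply: filterS (fl _ e0C) => t; rewrite normE ltcR.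
move=> fl; apply/cvgrPdist_lt => e e0.
have eE : e = (complex.Re e)%:C by rewrite RRe_real// gtr0_real.
rewrite eE ltcR in e0; rewrite eE.
by apply: filterS (fl _ e0) => t; rewrite normE ltcR.
Qed.

Lemma cauchy_net_cvg (T : Type) (F : set_system T) (f : T -> H) :
  ProperFilter F ->
  (forall e : R, 0 < e -> exists x, \forall t \near F, rnorm (x - f t) < e) ->
  cvg (f @ F).
Proof.
move=> FF fF; apply: cauchy_cvg; apply: cauchy_exP => e e0.
have eE : e = (complex.Re e)%:C by rewrite RRe_real// gtr0_real.
rewrite eE ltcR in e0; rewrite eE.
have [x xF] := fF _ e0; exists x.
by apply: filterS xF => t /=; rewrite -ball_normE /ball_/= normE ltcR.
Qed.

Lemma cvg_rinner (T : Type) (F : set_system T) (f : T -> H) l y (e : R) :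
  Filter F -> f @ F --> l -> 0 < e ->
  \forall t \near F, `|rinner l y - rinner (f t) y| < e.
Proof.
move=> FF /cvg_rnormP fl e0.
have ne : 0 < e / (rnorm y + 1) by rewrite divr_gt0// ltr_wpDl// rnorm_ge0.
apply: filterS (fl _ ne) => t.
rewrite ltr_pdivlMr ?ltr_wpDl ?rnorm_ge0// => lt.
rewrite -rinnerNl -rinnerDl; apply: le_lt_trans (cauchy_schwarz _ _) _.
by apply: le_lt_trans lt; rewrite ler_wpM2l ?rnorm_ge0 ?lerDl.
Qed.

Lemma cvg_inner (T : Type) (F : set_system T) (f : T -> H) l y :
  Filter F -> f @ F --> l ->
  (fun t => '[f t, y] : R[i]^o) @ F --> ('[l, y] : R[i]^o).
Proof.
move=> FF fl; apply/cvgrPdist_lt => e e0.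
have eE : e = (complex.Re e)%:C by rewrite RRe_real// gtr0_real.
rewrite eE ltcR in e0; rewrite eE.
have e2 : 0 < complex.Re e / 2 by rewrite divr_gt0.
apply: filterS
  (filterI (cvg_rinner y _ fl e2) (cvg_rinner ('i%C *: y) _ fl e2)) => t [].
rewrite !innerE; set a := rinner l y - _; set b := rinner l ('i%C *: y) - _.
move=> ha hb.
suff : `|(a +i* b : R[i])| < (complex.Re e)%:C by [].
rewrite normc_def ltcR /=.
rewrite -[ltRHS](@ger0_norm _ (complex.Re e)) ?ltW// -sqrtr_sqr.
rewrite ltr_sqrt ?exprn_gt0//.
rewrite -[a ^+ 2]real_normK ?num_real// -[b ^+ 2]real_normK ?num_real//.
by have := normr_ge0 a; have := normr_ge0 b; nra.
Qed.

End real_structure.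

(** * Riesz representation and adjoints *)

Section riesz.
Variables (R : realType) (H : hilbertType R).
Implicit Types x y z u v : H.

(** The representing vector minimizes [j x = |x|^2 - 2 g x]: for a
    functional [g x = <x, z>] one has [j x = |x - z|^2 - |z|^2].  The sets of
    near-minimizers of [j] form a filter base.  By the parallelogram law, the
    squared distance of two near-minimizers is controlled by how far their
    values exceed the infimum, so that filter is Cauchy; at its limit the
    derivative of [j] vanishes in every direction. *)
Lemma riesz_real (g : H -> R) (M : R) :
  {morph g : x y / x + y} -> (forall (a : R) x, g (a%:C *: x) = a * g x) ->
  (forall x, `|g x| <= M * rnorm x) ->
  exists z, forall x, g x = rinner x z.
Proof.
move=> gD gZ gM.
pose j x := rnorm x ^+ 2 - 2 * g x.
have j_ge x : - M ^+ 2 <= j x.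
  have := ler_norm (g x); have := gM x; have := sqr_ge0 (rnorm x - M).
  by rewrite /j; nra.
pose m := inf (range j).
have j_inf : has_inf (range j).
  split; first by exists (j 0), 0.
  by exists (- M ^+ 2) => _ [x _ <-].
have m_le x : m <= j x by apply: ge_inf => //; case: j_inf.
pose near_min (e : R) := [set x | j x < m + e].
pose F := filter_from [set e : R | 0 < e] near_min.
have FF : ProperFilter F.
  apply: filter_from_proper; last first.
    by move=> e e0; have [_ [x _ <-] lt] := inf_adherent e0 j_inf; exists x.
  apply: filter_from_filter; first by exists 1 => /=.
  move=> e1 e2 /= e10 e20; exists (Num.min e1 e2) => /=.
    by rewrite lt_min e10.
  by move=> x; rewrite /near_min/= -ltrBlDl lt_min !ltrBlDl => /andP[].
have Fmin (e : R) : 0 < e -> \forall x \near F, j x < m + e.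
  by move=> e0; exists e.
have : cvg (id @ F).
  apply: cauchy_net_cvg => e e0.
  have e4 : 0 < e ^+ 2 / 4 by rewrite divr_gt0// exprn_gt0.
  have [x xm] := filter_ex (Fmin _ e4).
  exists x; apply: filterS (Fmin _ e4) => t tm.
  rewrite -(@ltr_pXn2r _ 2) ?nnegrE ?rnorm_ge0 ?ltW//.
  (* The midpoint cannot go below the infimum. *)
  have := m_le ((2^-1)%:C *: (x + t)).
  rewrite /j gZ gD rnormZ exprMn real_normK ?num_real//.
  by have := parallelogram x t; move: xm tm; rewrite /j; lra.
move=> /cvg_ex[/= z Fz]; exists z => h; rewrite rinnerC.
apply/eqP; apply/negPn/negP => neq.
pose c x := rinner x h - g h; pose N := rnorm h ^+ 2.
have N0 : 0 <= N by rewrite sqr_ge0.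
(* [2 * c x] is the derivative of [j] at [x] in the direction [h]; a large
   derivative would let [j] descend below its infimum. *)
have c_small x e : j x < m + e -> c x ^+ 2 <= e * (1 + N).
  move=> xm; have N1 : 0 < 1 + N by lra.
  (* The exact minimum along the line is at [- c x / N]; the extra [1] covers
     the case [h = 0]. *)
  pose t := - c x / (1 + N).
  have tN : t * (1 + N) = - c x by rewrite /t divfK// gt_eqF.
  have := m_le (x + t%:C *: h).
  rewrite /j gD gZ rnorm_sqrD rnormZ exprMn real_normK ?num_real// rinnerZr.
  move: xm; rewrite /j -/N => xm mle.
  have : 0 <= e + 2 * t * c x + t ^+ 2 * N by rewrite /c; lra.
  rewrite -(@pmulr_lge0 _ (1 + N))//.
  have -> : (e + 2 * t * c x + t ^+ 2 * N) * (1 + N)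
    = e * (1 + N) + 2 * (t * (1 + N)) * c x + t * (t * (1 + N)) * N by ring.
  rewrite tN.
  have -> : t * - c x * N = - c x * (t * (1 + N) - t) by ring.
  have tc : 0 <= - c x * t.
    by rewrite /t mulrA divr_ge0 ?(ltW N1)// -expr2 sqr_ge0.
  by rewrite tN; nra.
have d0 : 0 < `|c z| by rewrite normr_gt0 subr_eq0 eq_sym.
have e0 : 0 < `|c z| ^+ 2 / (4 * (1 + N)).
  by rewrite divr_gt0 ?exprn_gt0//; lra.
have d2 : 0 < `|c z| / 2 by rewrite divr_gt0.
have [x [xm]] := filter_ex (filterI (Fmin _ e0) (cvg_rinner h _ Fz d2)).
have -> : rinner z h - rinner x h = c z - c x by rewrite /c; ring.
have := c_small _ _ xm.
have -> : `|c z| ^+ 2 / (4 * (1 + N)) * (1 + N) = (`|c z| / 2) ^+ 2.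
  by field; apply/eqP; lra.
rewrite -[c x ^+ 2]real_normK ?num_real// ler_pXn2r ?nnegrE ?divr_ge0// => cx.
by have := ler_distD (c x) (c z) 0; rewrite !subr0; lra.
Qed.

End riesz.

Section adjoint.
Variables (R : realType) (H : hilbertType R).
Implicit Types x y z : H.

(** The vector representing the real part of a complex linear functional
    represents the functional itself: the imaginary part at [x] is minus the
    real part at [i x]. *)
Lemma adjointP (H' : hilbertType R) (T : 'B(H, H')) x (y : H') :
  '[T x, y] = '[x, adjoint T y].
Proof.
suff : exists z, forall x, '[T x, y] = '[x, z].
  by move=> ex; exact: (xgetPex 0 ex).
have [z zP] : exists z, forall x, rinner (T x) y = rinner x z.
  have [M TM] := @bounded_opP _ _ _ T.
  apply: (@riesz_real _ _ (fun x => rinner (T x) y) (complex.Re M * rnorm y)).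
  - by move=> u v; rewrite linearD rinnerDl.
  - by move=> a u; rewrite linearZ rinnerZl.
  - move=> u; apply: le_trans (cauchy_schwarz _ _) _.
    rewrite mulrAC ler_wpM2r ?rnorm_ge0//.
    have := TM u; rewrite !normE lecE => /andP[_] /=.
    by case: M {TM} => a b /=; rewrite mulr0 subr0.
exists z => {}x; rewrite !innerE zP.
have -> // : rinner (T x) ('i%C *: y) = rinner x ('i%C *: z).
by apply: oppr_inj; rewrite -[RHS]rinner_il -zP linearZ rinner_il.
Qed.

Lemma adjointD (H' : hilbertType R) (T : 'B(H, H')) :
  {morph adjoint T : u v / u + v}.
Proof.
by move=> u v; apply: inner_eq => z; rewrite -adjointP !linearDr /= !adjointP.
Qed.

Lemma adjointZ (H' : hilbertType R) (T : 'B(H, H')) a :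
  {morph adjoint T : u / a *: u}.
Proof.
by move=> u; apply: inner_eq => z; rewrite -adjointP !linearZr_LR /= adjointP.
Qed.

End adjoint.

(** * Polarization *)

Section polarization.
Variables (R : realType) (H : hilbertType R).
Implicit Types x y z : H.
Variable q : H -> H.
Hypothesis qD : {morph q : x y / x + y}.
Hypothesis qi : forall x, q ('i%C *: x) = 'i%C *: q x.
Let Re_form x := complex.Re '[q x, x].
Let Im_form x := complex.Im '[q x, x].

(** Additivity and compatibility with [i] are all that is used of [q].  The real
    parts of the form give [rinner (q x) y + rinner (q y) x]; replacing [y] by
    [i y], the imaginary parts give [rinner (q y) x - rinner (q x) y]. *)
Lemma polarization x y : 2 * rinner (q x) y =
  (Re_form (x + y) - Re_form x - Re_form y)
  - (Im_form (x + 'i%C *: y) - Im_form x - Im_form y).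
Proof.
have ii z : 'i%C *: ('i%C *: z) = - z by rewrite scalerA -expr2 sqr_i scaleN1r.
rewrite /Re_form /Im_form !innerE /= !qD qi scalerDr ii.
rewrite !rinnerDl !rinnerDr !rinnerNr !rinner_il ii rinnerNr.
by ring.
Qed.

(** Polarize at [y = q x].  This is false over the reals, as rotations of the
    plane by a right angle show. *)
Lemma form_eq0 x : (forall x, '[q x, x] = 0) -> q x = 0.
Proof.
move=> q0; apply/rnorm0_eq0/eqP; rewrite -sqrf_eq0 -rinnerxx.
have := polarization x (q x); rewrite /Re_form /Im_form !q0 /=; lra.
Qed.

End polarization.

(** * Bounded families and unconditional convergence *)

Section finite_sums.
Variables (I : choiceType) (V : zmodType) (a : I -> V).
Local Notation psum := (summability.partial_sum a).

Lemma partial_sumE (A : {fset I}) : psum A = \sum_(i <- A) a i.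
Proof. by rewrite /summability.partial_sum big_seq_fsetE. Qed.

Lemma partial_sumU (A B : {fset I}) : [disjoint A & B]%fset ->
  psum (A `|` B)%fset = psum A + psum B.
Proof.
move=> AB; rewrite !partial_sumE -big_cat; apply: perm_big.
apply: uniq_perm; rewrite ?cat_uniq ?fset_uniq ?andbT//=.
  apply/hasPn => i Bi; apply/negP => Ai.
  by move/fdisjointP: AB => /(_ _ Ai); rewrite Bi.
by move=> i; rewrite mem_cat in_fsetU.
Qed.

End finite_sums.

(** Sums over sets containing some finite [B] are close to the limit, and any
    other sum differs from one of these by a sum over a subset of [B]. *)
Lemma cvg_partial_sum_bounded (I : choiceType) (K : numFieldType)
    (V : normedModType K) (f : I -> V) :
  cvg (summability.partial_sum f @ summability.totally) ->
  exists M : K, forall A, `|summability.partial_sum f A| <= M.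
Proof.
move=> /cvg_ex[/= l /cvgrPdist_lt/(_ 1 ltr01)[B _ /= Bl]].
pose nf i := `|f i|.
exists (`|l| + 1 + summability.partial_sum nf B) => A.
have dAB : [disjoint A & B `\` A]%fset.
  by apply/fdisjointP => i Ai; rewrite in_fsetD Ai.
have dBA : [disjoint B `&` A & B `\` A]%fset.
  by apply/fdisjointP => i; rewrite in_fsetI in_fsetD => /andP[_ ->].
have nf0 C : 0 <= summability.partial_sum nf C.
  by apply: sumr_ge0 => i _; apply: normr_ge0.
have le_nf C : `|summability.partial_sum f C| <= summability.partial_sum nf C.
  exact: ler_norm_sum.
have -> : summability.partial_sum f A =
    - (l - summability.partial_sum f (A `|` B `\` A)%fset) + l
    - summability.partial_sum f (B `\` A)%fset.
  by rewrite partial_sumU// opprB subrK addrK.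
have -> : summability.partial_sum nf B =
    summability.partial_sum nf (B `&` A)%fset
    + summability.partial_sum nf (B `\` A)%fset.
  by rewrite -partial_sumU// fsetID.
apply: le_trans (ler_normB _ _) _; apply: lerD.
  rewrite addrC; apply: le_trans (ler_normD _ _) _; apply: lerD => //.
  rewrite normrN ltW// Bl//=.
  by apply/fsubsetP => i Bi; rewrite in_fsetU in_fsetD Bi andbT orbN.
by apply: le_trans (le_nf _) _; rewrite lerDr.
Qed.

Section boundedness.
Variables (R : realType) (H : hilbertType R).
Implicit Types x y z u v : H.

(** Otherwise some [p] in [A] has an arbitrarily large norm, and every closed
    ball contains a ball a quarter as wide on which such a [p] has large inner
    products: its centre is obtained by moving half a radius along [p] or
    against it.  The nested balls so obtained have a common point, at which
    the family is not bounded. *)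
Lemma uniform_boundedness (A : set H) :
  (forall y, exists M : R, forall p, A p -> `|rinner y p| <= M) ->
  exists M : R, forall p, A p -> rnorm p <= M.
Proof.
move=> Abd; apply: contrapT => /forallNP unbd.
have large (M : R) : exists2 p, A p & M < rnorm p.
  have /existsNP[p /not_implyP[Ap /negP]] := unbd M.
  by rewrite -ltNge; exists p.
pose r n : R := 4^-1 ^+ n.
have r0 n : 0 < r n by rewrite exprn_gt0// invr_gt0.
have rS n : r n = 4 * r n.+1 by rewrite /r exprS; field.
have step (s : H * nat) : exists x', rnorm (x' - s.1) <= r s.2 / 2 /\
    exists2 p, A p &
      forall y, rnorm (y - x') <= r s.2.+1 -> s.2%:R <= `|rinner y p|.
  case: s => x n /=.
  have [p Ap plarge] := large (n%:R / r n.+1).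
  rewrite ltr_pdivrMr// in plarge.
  have p0 : 0 < rnorm p.
    by rewrite -(pmulr_lgt0 _ (r0 n.+1)) (le_lt_trans _ plarge).
  pose u := (r n / 2 / rnorm p)%:C *: p.
  have nu : rnorm u = r n / 2.
    by rewrite rnormZ ger0_norm ?divr_ge0 ?ltW// divfK// gt_eqF.
  have up : rinner u p = 2 * r n.+1 * rnorm p.
    by rewrite rinnerZl rinnerxx rS; field; rewrite gt_eqF.
  have [x' x'x x'p] : exists2 x', rnorm (x' - x) <= r n / 2 &
      2 * r n.+1 * rnorm p <= `|rinner x' p|.
    have [le|lt] := lerP (2 * r n.+1 * rnorm p) `|rinner (x + u) p|.
      by exists (x + u); rewrite // addrAC subrr add0r nu.
    exists (x - u); first by rewrite addrAC subrr add0r rnormN nu.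
    move: lt; rewrite !rinnerDl rinnerNl up => lt.
    have := ler_norm (rinner x p + 2 * r n.+1 * rnorm p).
    have := ler_norm (- (rinner x p - 2 * r n.+1 * rnorm p)); rewrite normrN.
    have := mulr_gt0 (r0 n.+1) p0.
    by lra.
  exists x'; split=> //; exists p => // y yx'.
  have := cauchy_schwarz (y - x') p; rewrite rinnerDl rinnerNl.
  have := ler_distD (rinner y p) (rinner x' p) 0.
  rewrite !subr0 distrC => tri cs.
  have := ler_wpM2r (ltW p0) yx'.
  by lra.
have [f fP] := choice step.
(* The choice made at stage [n] keeps the ball of radius [r n.+1] about
   [xs n.+1] inside the ball of radius [r n] about [xs n]. *)
pose fix xs n := if n is k.+1 then f (xs k, k) else 0.
have nest n m : (n <= m)%N -> rnorm (xs m - xs n) + r m <= r n.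
  elim: m => [|m IH].
    by rewrite leqn0 => /eqP->; rewrite subrr /rnorm normr0 add0r.
  rewrite leq_eqVlt => /predU1P[->|/IH nm].
    by rewrite subrr /rnorm normr0 add0r.
  have [/= h _] := fP (xs m, m).
  have := rnormD (xs m.+1 - xs m) (xs m - xs n); rewrite addrA subrK /=.
  by have := rS m; have := r0 m; lra.
have r_small (e : R) : 0 < e -> exists n, r n < e.
  move=> e0.
  exists (Num.truncn e^-1).+1; rewrite /r exprVn invf_plt ?posrE ?exprn_gt0//.
  apply: lt_trans (truncnS_gt _) _; rewrite -natrX ltr_nat; exact: ltn_expl.
have : cvg (xs @ \oo).
  apply: cauchy_net_cvg => e /r_small[n rn]; exists (xs n).
  exists n => // m /= nm; rewrite rnorm_distC.
  by have := nest _ _ nm; have := r0 m; lra.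
move=> /cvg_ex[/= l xl].
have [M lM] := Abd l.
(* The lower bound [n] holds at the centres [xs m]; the [1] absorbs the passage
   from [xs m] to the limit [l]. *)
pose n := (Num.truncn (M + 1)).+1.
have nM : M + 1 < n%:R by rewrite truncnS_gt.
have [_ [p Ap pP]] := fP (xs n, n).
have [m [/= xm nm]] :=
  filter_ex (filterI (cvg_rinner p _ xl ltr01) (nbhs_infty_ge n.+1)).
have := lM _ Ap.
have : n%:R <= `|rinner (xs m) p|.
  by apply: pP; have := nest _ _ nm; have := r0 m; rewrite /=; lra.
have := ler_distD (rinner l p) (rinner (xs m) p) 0; rewrite !subr0 distrC.
by lra.
Qed.

(** If the sums were not Cauchy, disjoint blocks with sums of norm at least [e]
    could be found forever, and combined with suitable signs into vectors of
    unbounded norm, although these are differences of two partial sums.  The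
    geometry of [H] matters: in [c_0] the unit vector basis is a
    counterexample. *)
Lemma bounded_sums_cvg (I : choiceType) (a : I -> H) (M : R) :
  (forall A, rnorm (summability.partial_sum a A) <= M) ->
  cvg (summability.partial_sum a @ summability.totally).
Proof.
move=> aM; pose S := summability.partial_sum a; rewrite -/S.
have tail (e : R) : 0 < e ->
    exists A, forall B, [disjoint A & B]%fset -> rnorm (S B) < e.
  move=> e0; apply: contrapT => /forallNP blocks.
  have {}blocks A : exists2 B, [disjoint A & B]%fset & e <= rnorm (S B).
    have /existsNP[B /not_implyP[AB /negP]] := blocks A.
    by rewrite -leNgt; exists B.
  (* Add one block at a time: as the squared norms of [u + b] and [u - b] have
     mean [|u|^2 + |b|^2], one of the two signs does not lose anything.
     [P] and [N] collect the blocks taken with each sign. *)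
  have signs n : exists P N, n%:R * e ^+ 2 <= rnorm (S P - S N) ^+ 2.
    elim: n => [|n [P [N IH]]].
      by exists fset0, fset0; rewrite mul0r sqr_ge0.
    have [B dB eB] := blocks (P `|` N)%fset.
    have [PB NB] : [disjoint P & B]%fset /\ [disjoint N & B]%fset.
      by move: dB; rewrite fdisjointUX => /andP.
    have eB2 : e ^+ 2 <= rnorm (S B) ^+ 2.
      by rewrite lerXn2r// nnegrE ?rnorm_ge0// ltW.
    have := parallelogram (S P - S N) (S B).
    have [le par|lt par] :=
      lerP (n.+1%:R * e ^+ 2) (rnorm (S P - S N + S B) ^+ 2).
      exists (P `|` B)%fset, N.
      by rewrite [S (P `|` B)%fset]partial_sumU// addrAC.
    exists P, (N `|` B)%fset.
    rewrite [S (N `|` B)%fset]partial_sumU// opprD addrA.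
    by move: lt; rewrite -natr1; lra.
  pose n := (Num.truncn ((2 * M) ^+ 2 / e ^+ 2)).+1.
  have [P [N]] := signs n.
  have : (2 * M) ^+ 2 < n%:R * e ^+ 2.
    by rewrite -ltr_pdivrMr ?exprn_gt0// truncnS_gt.
  have : rnorm (S P - S N) ^+ 2 <= (2 * M) ^+ 2.
    rewrite lerXn2r ?nnegrE ?rnorm_ge0//.
      by have := aM P; have := rnorm_ge0 (S P); rewrite -/(S P); lra.
    have := rnormD (S P) (- S N); rewrite rnormN.
    by have := aM P; have := aM N; rewrite -/(S P) -/(S N); lra.
  by lra.
apply: cauchy_net_cvg => e /tail[A Ae]; exists (S A).
exists A => // B /= AB.
have dA : [disjoint A & B `\` A]%fset.
  by apply/fdisjointP => i Ai; rewrite in_fsetD Ai.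
rewrite rnorm_distC -(fsetID A B) (fsetIidPr AB).
by rewrite [S (_ `|` _)%fset]partial_sumU// addrAC subrr add0r Ae.
Qed.

End boundedness.

(** * The frame operator *)

Section frame_operator.
Variables (R : realType) (H : hilbertType R).
Variables (I : countType) (V : I -> closedSubspace H).
Variables Phi Psi : forall i, 'B(H, subspace_of (V i)).

Definition partial_operator (A : {fset I}) (x : H) : H :=
  summability.partial_sum (fun i => adjoint (Psi i) (Phi i x)) A.

Lemma partial_operatorD A : {morph partial_operator A : x y / x + y}.
Proof.
move=> x y; rewrite -big_split; apply: eq_bigr => i _ /=.
by rewrite linearD adjointD.
Qed.

Lemma partial_operatorZ A a : {morph partial_operator A : x / a *: x}.
Proof.
move=> x; rewrite /partial_operator /summability.partial_sum scaler_sumr.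
by apply: eq_bigr => i _; rewrite linearZ adjointZ.
Qed.

Lemma partial_operator_form A x : '[partial_operator A x, x] =
  summability.partial_sum (fun i => '[Phi i x, Psi i x] : R[i]^o) A.
Proof.
rewrite linear_sumlz; apply: eq_bigr => i _.
by rewrite [LHS]innerC -adjointP -innerC.
Qed.

Hypothesis summ : frame_summable Phi Psi.

Lemma partial_operator_form_bounded x :
  exists M : R, forall A, `|complex.Re '[partial_operator A x, x]| <= M /\
                          `|complex.Im '[partial_operator A x, x]| <= M.
Proof.
have [M bd] := cvg_partial_sum_bounded (@summ x).
exists (complex.Re M) => A; have := bd A; rewrite -partial_operator_form.
case: '[_, _] => a b; case: M {bd} => c d.
rewrite normc_def lecE /= => /andP[_] le_cM.
split; apply: le_trans le_cM; rewrite -sqrtr_sqr ler_wsqrtr//=.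
  by rewrite lerDl sqr_ge0.
by rewrite lerDr sqr_ge0.
Qed.

(** Polarization bounds the inner products of these vectors with any fixed
    [y], which is what uniform boundedness asks for. *)
Lemma partial_operator_bounded x :
  exists M : R, forall A, rnorm (partial_operator A x) <= M.
Proof.
pose P := [set p | exists A, p = partial_operator A x].
suff [M PM] : exists M : R, forall p, P p -> rnorm p <= M.
  by exists M => A; apply: PM; exists A.
apply: uniform_boundedness => y.
have [M1 b1] := partial_operator_form_bounded (x + y).
have [M2 b2] := partial_operator_form_bounded (x + 'i%C *: y).
have [M3 b3] := partial_operator_form_bounded x.
have [M4 b4] := partial_operator_form_bounded y.
exists (M1 + M2 + M3 *+ 2 + M4 *+ 2) => _ [A ->]; rewrite rinnerC.
have := polarization (partial_operatorD A) (partial_operatorZ A 'i%C) x y.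
have [+ _] := b1 A; have [_] := b2 A; have [] := b3 A; have [] := b4 A.
rewrite !ler_norml; lra.
Qed.

Lemma frame_operator_cvg x :
  partial_operator ^~ x @ summability.totally --> frame_operator Phi Psi x.
Proof.
by have [M bd] := partial_operator_bounded x; apply: bounded_sums_cvg bd.
Qed.

Lemma frame_operatorD : {morph frame_operator Phi Psi : x y / x + y}.
Proof.
move=> x y; apply: (cvg_lim (@norm_hausdorff _ H)).
rewrite [X in X @ _ --> _](_ : _ =
  partial_operator ^~ x \+ partial_operator ^~ y).
  by apply: cvgD; exact: frame_operator_cvg.
by apply/funext => A; exact: partial_operatorD.
Qed.

Lemma frame_operatorZ a : {morph frame_operator Phi Psi : x / a *: x}.
Proof.
move=> x; apply: (cvg_lim (@norm_hausdorff _ H)).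
rewrite [X in X @ _ --> _](_ : _ = fun A => a *: partial_operator A x).
  by apply: cvgZr; exact: frame_operator_cvg.
by apply/funext => A; exact: partial_operatorZ.
Qed.

Lemma frame_operator_form x :
  '[frame_operator Phi Psi x, x] = frame_sum Phi Psi x.
Proof.
apply/esym/(cvg_lim (@norm_hausdorff _ _)).
rewrite [X in X @ _ --> _](_ : _ = fun A => '[partial_operator A x, x]).
  by apply: cvg_inner; exact: frame_operator_cvg.
by apply/funext => A; rewrite partial_operator_form.
Qed.

End frame_operator.

Theorem corollary3p12 (R : realType) (H : hilbertType R) (hH : separable H)
    (I : countType) (V : I -> closedSubspace H)
    (Phi Psi : forall i : I, 'B(H, subspace_of (V i))) (K : 'B(H, H))
    (hframe : bi_g_frame Phi Psi) :
  tight_K_bi_g_frame Phi Psi K <->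
  exists2 A : R, 0 < A &
    frame_operator Phi Psi = (fun x => A%:C *: K (adjoint K x)).
Proof.
have summ : frame_summable Phi Psi by case: hframe.
have KK A x : '[A%:C *: K (adjoint K x), x] = A%:C * `|adjoint K x| ^+ 2.
  by rewrite linearZl_LR /= adjointP -inner_normE.
split=> [[_ [A A0 tight]]|[A A0 SE]].
  exists A => //; apply/funext => x.
  (* Tightness makes the quadratic form of this linear operator vanish. *)
  pose q x := frame_operator Phi Psi x - A%:C *: K (adjoint K x).
  apply/subr0_eq/(@form_eq0 _ _ q) => [u v|u|u]; rewrite /q.
  - by rewrite frame_operatorD// adjointD linearD scalerDr opprD addrACA.
  - rewrite frame_operatorZ// adjointZ [K _]linearZ /= scalerBr.
    by rewrite !scalerA [A%:C * _]mulrC.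
  - by rewrite linearBl /= KK frame_operator_form// tight subrr.
split=> //; exists A => // x.
by rewrite -frame_operator_form// SE KK.
Qed.
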